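(* The category $\mathbf{PZLC}$ is dually equivalent to the category $\mathbf{GBPL}$ whose objects are all generalized Boolean pseudolattices and whose morphisms are all $\{0\}$-pseudolattice homomorphisms $\varphi:I\to J$ between its objects such that for every $b\in J$ there exists $a\in I$ with $b\le\varphi(a)$.
   Context: $\mathbf{PZLC}$ is the category of all locally compact zero-dimensional (having a base of clopen sets) Hausdorff spaces and all perfect maps between them. A map is perfect if it is continuous, closed and has compact point-inverses (it need not be onto). A pseudolattice is a poset having all finite non-empty meets and joins; a $\{0\}$-pseudolattice is a pseudolattice with a bottom element $0$. A $\{0\}$-pseudolattice homomorphism is a map preserving $0$ and all finite non-empty meets and joins. A generalized Boolean pseudolattice is a distributive $\{0\}$-pseudolattice $A$ such that for all $a,b,c\in A$ with $b\le a\le c$ there exists $x\in A$ with $a\wedge x=b$ and $a\vee x=c$. Composition and identities in $\mathbf{GBPL}$ are the usual ones of functions. Two categories are dually equivalent if one is equivalent to the opposite of the other. *)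

(* Defs.v *)
From HB Require Import structures.
From mathcomp Require Import all_boot all_order.
From mathcomp Require Import all_classical topology.

Set Implicit Arguments.
Unset Strict Implicit.
Unset Printing Implicit Defensive.

Import Order.Theory.

Local Open Scope classical_set_scope.
Local Open Scope order_scope.

Record category := Category {
  obj :> Type;
  hom : obj -> obj -> Type;
  idm : forall X : obj, hom X X;
  compm : forall X Y Z : obj, hom Y Z -> hom X Y -> hom X Z;
  compm_idl : forall (X Y : obj) (f : hom X Y), compm (idm Y) f = f;
  compm_idr : forall (X Y : obj) (f : hom X Y), compm f (idm X) = f;
  compmA : forall (W X Y Z : obj) (h : hom Y Z) (g : hom X Y) (f : hom W X),
    compm h (compm g f) = compm (compm h g) f
}.

Definition opposite (C : category) : category :=
  @Category C (fun X Y => hom Y X) (fun X => idm X)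
    (fun X Y Z g f => compm f g)
    (fun X Y f => compm_idr f)
    (fun X Y f => compm_idl f)
    (fun W X Y Z h g f => esym (compmA f g h)).

Record functor (C D : category) := Functor {
  fobj :> C -> D;
  fmap : forall X Y : C, hom X Y -> hom (fobj X) (fobj Y);
  fmap_id : forall X : C, fmap (idm X) = idm (fobj X);
  fmap_comp : forall (X Y Z : C) (g : hom Y Z) (f : hom X Y),
    fmap (compm g f) = compm (fmap g) (fmap f)
}.

Definition functor_id (C : category) : functor C C :=
  @Functor C C (fun X => X) (fun X Y f => f)
    (fun X => erefl) (fun X Y Z g f => erefl).

Definition functor_comp (C D E : category) (G : functor D E) (F : functor C D) :
    functor C E :=
  @Functor C E (fun X => G (F X)) (fun X Y f => fmap G (fmap F f))
    (fun X => etrans (congr1 (fmap G (Y := F X)) (fmap_id F X)) (fmap_id G (F X)))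
    (fun X Y Z g f => etrans (congr1 (fmap G (Y := F Z)) (fmap_comp F g f))
                             (fmap_comp G (fmap F g) (fmap F f))).

Definition is_iso (C : category) (X Y : C) (f : hom X Y) : Prop :=
  exists g : hom Y X, compm g f = idm X /\ compm f g = idm Y.

Definition naturally_isomorphic (C D : category) (F G : functor C D) : Prop :=
  exists eta : forall X : C, hom (F X) (G X),
    (forall X : C, is_iso (eta X)) /\
    (forall (X Y : C) (f : hom X Y),
        compm (eta Y) (fmap F f) = compm (fmap G f) (eta X)).

Definition equivalent (C D : category) : Prop :=
  exists (F : functor C D) (G : functor D C),
    naturally_isomorphic (functor_id C) (functor_comp G F) /\
    naturally_isomorphic (functor_comp F G) (functor_id D).

Definition dually_equivalent (C D : category) : Prop :=
  equivalent C (opposite D).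

(* This is the existence of a base of clopen sets; the library predicate
   [zero_dimensional] only separates points by clopen sets, which is weaker in
   general. *)
Definition has_clopen_base (X : topologicalType) : Prop :=
  exists2 B : set (set X), basis B & B `<=` clopen.

Record perfect_map (X Y : topologicalType) (f : X -> Y) : Prop := PerfectMap {
  perfect_continuous : continuous f;
  perfect_closed : forall A : set X, closed A -> closed (f @` A);
  perfect_fiber : forall y : Y, compact (f @^-1` [set y])
}.

Record pzlc_obj := PzlcObj {
  pzlc_space :> topologicalType;
  pzlc_locally_compact : locally_compact [set: pzlc_space];
  pzlc_clopen_base : has_clopen_base pzlc_space;
  pzlc_hausdorff : hausdorff_space pzlc_space
}.

Record pzlc_hom (X Y : pzlc_obj) := PzlcHom {
  pzlc_fun :> X -> Y;
  pzlc_perfect : perfect_map pzlc_fun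
}.

Lemma pzlc_hom_eq (X Y : pzlc_obj) (f g : pzlc_hom X Y) :
  pzlc_fun f = pzlc_fun g -> f = g.
Proof.
case: f g => [f pf] [g pg] /= fg; rewrite fg in pf *.
by congr PzlcHom; exact: Prop_irrelevance.
Qed.

Lemma perfect_map_id (X : topologicalType) : perfect_map (@idfun X).
Proof.
split=> [x|A cA|y].
- exact: cvg_id.
- by rewrite image_id.
- by rewrite preimage_id; exact: compact_set1.
Qed.

Lemma perfect_preimage_compact (X Y : topologicalType) (f : X -> Y)
  (K : set Y) : perfect_map f -> compact K -> compact (f @^-1` K).
Proof.
move=> [cf clf fibf] cK F PF FK.
have [y [Ky yF]] := cK (f @ F) _ FK.
have fibN A : F A -> closure A `&` f @^-1` [set y] !=set0.
  move=> FA.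
  have : closure (f @` closure A) y.
    move=> B By; apply: yF => //=.
    by apply: filterS FA => x Ax /=; exists x => //; exact: subset_closure.
  have /closure_id <- := clf _ (@closed_closure _ A).
  by move=> [x Ax fxy]; exists x.
pose G := filter_from F (fun A => closure A `&` f @^-1` [set y]).
have PG : ProperFilter G.
  apply: filter_from_proper => //; apply: filter_from_filter.
    by exists setT; exact: filterT.
  move=> A B FA FB; exists (A `&` B); first exact: filterI.
  by move=> x [/closureI[cA cB] fx].
have [x [fx xG]] : (f @^-1` [set y]) `&` cluster G !=set0.
  by apply: fibf; exists setT; [exact: filterT|move=> x []].
exists x; split; first by rewrite /preimage /= fx.
move=> A B FA; rewrite nbhsE => -[O [oO Ox] OB].
have [z [[cAz _] Oz]] : closure A `&` f @^-1` [set y] `&` O !=set0.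
  by apply: xG; [exists A|exact: open_nbhs_nbhs].
have [w [Aw Ow]] := cAz O (open_nbhs_nbhs (conj oO Oz)).
by exists w; split=> //; exact: OB.
Qed.

Lemma perfect_map_comp (X Y Z : topologicalType) (g : Y -> Z) (f : X -> Y) :
  perfect_map g -> perfect_map f -> perfect_map (g \o f).
Proof.
move=> pg pf; split=> [x|A cA|z].
- by apply: continuous_comp; [exact: perfect_continuous|exact: perfect_continuous].
- by rewrite -image_comp; do 2 apply: perfect_closed => //.
- rewrite comp_preimage; apply: perfect_preimage_compact => //.
  exact: perfect_fiber.
Qed.

Definition pzlc_id (X : pzlc_obj) : pzlc_hom X X :=
  PzlcHom (perfect_map_id X).

Definition pzlc_comp (X Y Z : pzlc_obj) (g : pzlc_hom Y Z) (f : pzlc_hom X Y) :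
    pzlc_hom X Z :=
  PzlcHom (perfect_map_comp (pzlc_perfect g) (pzlc_perfect f)).

Definition PZLC : category :=
  @Category pzlc_obj pzlc_hom pzlc_id pzlc_comp
    (fun X Y f => pzlc_hom_eq (f := pzlc_comp (pzlc_id Y) f) (g := f) erefl)
    (fun X Y f => pzlc_hom_eq (f := pzlc_comp f (pzlc_id X)) (g := f) erefl)
    (fun W X Y Z h g f => pzlc_hom_eq (f := pzlc_comp h (pzlc_comp g f))
       (g := pzlc_comp (pzlc_comp h g) f) erefl).

(* In [bDistrLatticeType], meets and joins are binary and there is a bottom,
   while a top is not required: these are exactly the distributive
   {0}-pseudolattices. *)
Record gbpl_obj := GbplObj {
  gbpl_display : Order.disp_t;
  gbpl_lattice :> bDistrLatticeType gbpl_display;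
  gbpl_complement : forall a b c : gbpl_lattice, b <= a -> a <= c ->
    exists x : gbpl_lattice, a `&` x = b /\ a `|` x = c
}.

(* The library's [{blmorphism I -> J}] only asks for preservation of the bottom
   element, so the three preservation properties are listed here. *)
Record pseudolattice0_morphism (d d' : Order.disp_t) (I : bLatticeType d)
    (J : bLatticeType d') (phi : I -> J) : Prop := Pseudolattice0Morphism {
  pm_bot : phi \bot = \bot;
  pm_meet : {morph phi : x y / x `&` y};
  pm_join : {morph phi : x y / x `|` y}
}.

Definition cofinal_map (d d' : Order.disp_t) (I : porderType d)
    (J : porderType d') (phi : I -> J) : Prop :=
  forall b : J, exists a : I, b <= phi a.

Record gbpl_hom (I J : gbpl_obj) := GbplHom {
  gbpl_fun :> I -> J;
  gbpl_morphism : pseudolattice0_morphism gbpl_fun;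
  gbpl_cofinal : cofinal_map gbpl_fun
}.

Lemma gbpl_hom_eq (I J : gbpl_obj) (f g : gbpl_hom I J) :
  gbpl_fun f = gbpl_fun g -> f = g.
Proof.
case: f g => [f mf cf] [g mg cg] /= fg; rewrite fg in mf cf *.
by congr GbplHom; exact: Prop_irrelevance.
Qed.

Lemma pseudolattice0_morphism_id (d : Order.disp_t) (I : bLatticeType d) :
  pseudolattice0_morphism (@idfun I).
Proof. by []. Qed.

Lemma pseudolattice0_morphism_comp (d d' d'' : Order.disp_t)
  (I : bLatticeType d) (J : bLatticeType d') (K : bLatticeType d'')
  (g : J -> K) (f : I -> J) :
  pseudolattice0_morphism g -> pseudolattice0_morphism f ->
  pseudolattice0_morphism (g \o f).
Proof.
move=> [g0 gI gU] [f0 fI fU].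
by split=> [|x y|x y] /=; rewrite ?f0 ?fI ?fU.
Qed.

Lemma cofinal_map_id (d : Order.disp_t) (I : porderType d) :
  cofinal_map (@idfun I).
Proof. by move=> b; exists b. Qed.

Lemma gbpl_cofinal_comp (I J K : gbpl_obj) (g : gbpl_hom J K)
  (f : gbpl_hom I J) : cofinal_map (g \o f).
Proof.
move=> c; have [b cb] := gbpl_cofinal g c; have [a ba] := gbpl_cofinal f b.
exists a; apply: le_trans cb _ => /=.
by rewrite leEmeet -(pm_meet (gbpl_morphism g)) (meet_l ba).
Qed.

Definition gbpl_id (I : gbpl_obj) : gbpl_hom I I :=
  GbplHom (pseudolattice0_morphism_id I) (@cofinal_map_id _ I).

Definition gbpl_comp (I J K : gbpl_obj) (g : gbpl_hom J K) (f : gbpl_hom I J) :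
    gbpl_hom I K :=
  GbplHom (pseudolattice0_morphism_comp (gbpl_morphism g) (gbpl_morphism f))
    (gbpl_cofinal_comp g f).

Definition GBPL : category :=
  @Category gbpl_obj gbpl_hom gbpl_id gbpl_comp
    (fun I J f => gbpl_hom_eq (f := gbpl_comp (gbpl_id J) f) (g := f) erefl)
    (fun I J f => gbpl_hom_eq (f := gbpl_comp f (gbpl_id I)) (g := f) erefl)
    (fun I J K L h g f => gbpl_hom_eq (f := gbpl_comp h (gbpl_comp g f))
       (g := gbpl_comp (gbpl_comp h g) f) erefl).

(* Main.v *)
(** Stone duality without a unit. A generalized Boolean pseudolattice [A] is
    sent to its space of prime filters, topologized by the sets [basic a] of
    the prime filters containing [a]; these sets are compact, hence clopen, and
    exhaust the compact open sets. Cofinality of a homomorphism is what makes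
    the inverse image of a prime filter nonempty. Conversely a space is sent to
    its compact open sets, and perfectness of a map makes inverse images of
    compact sets compact. *)
From HB Require Import structures.
From mathcomp Require Import all_boot all_order.
From mathcomp Require Import all_classical topology.
Require Import Defs.

Set Implicit Arguments.
Unset Strict Implicit.
Unset Printing Implicit Defensive.

Import Order.Theory.

Local Open Scope classical_set_scope.

(** * Compact sets and perfect maps *)

(** If no member of [P] covered [K], the differences of [K] with members of [P] would be nonempty
    and, by closure under unions, would form a filter base. A cluster point in [K] lies in some open
    member of [P], which its own difference misses. *)
Lemma compact_directed_cover (T : topologicalType) (K : set T)
    (P : set (set T)) :
  compact K -> P set0 -> setU_closed P ->
  (forall x, K x -> exists2 U, P U & open U /\ U x) ->
  exists2 U, P U & K `<=` U.
Proof.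
move=> cK P0 PU Kcov; apply: contrapT => noU.
pose F := filter_from P (fun U => K `\` U).
have PF : ProperFilter F.
  apply: filter_from_proper.
    apply: filter_from_filter; first by exists set0.
    move=> U V PPU PV; exists (U `|` V); first exact: PU.
    by rewrite setDUr.
  move=> U PPU; apply: contrapT => /nonemptyPn; rewrite setD_eq0 => KU.
  by apply: noU; exists U.
have [|x [Kx xF]] := cK F PF; first by exists set0; rewrite // setD0.
have [U PPU [oU Ux]] := Kcov x Kx.
have [y [[_ nUy] Uy]] : (K `\` U) `&` U !=set0.
  by apply: xF; [exists U|exact: open_nbhs_nbhs].
exact: nUy.
Qed.

(** Near [y] only the part of [A] over [V] matters; it is compact, so its image is compact and hence
    closed in the Hausdorff space [Y]. The fibre of [y] is a closed subset of the compact preimage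
    of [V]. *)
Lemma locally_compact_preimage_perfect (X Y : topologicalType) (f : X -> Y) :
  hausdorff_space Y -> continuous f ->
  (forall y : Y, exists2 V, nbhs y V & closed V /\ compact (f @^-1` V)) ->
  perfect_map f.
Proof.
move=> hY cf Vcov; split=> // [A cA y yA|y].
  have [V Vy [cV fV]] := Vcov y.
  have cAV : compact (A `&` f @^-1` V).
    apply: subclosed_compact fV _ => //; apply: closedI => //.
    by move/continuous_closedP: cf; apply.
  have cfAV : closed (f @` (A `&` f @^-1` V)).
    apply: compact_closed => //; apply: continuous_compact cAV.
    exact: continuous_subspaceT.
  have : closure (f @` (A `&` f @^-1` V)) y.
    move=> W Wy; have [_ [[x Ax <-] [Wx Vx]]] := yA _ (filterI Wy Vy).
    by exists (f x); split=> //; exists x.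
  by move/cfAV => [x [Ax _] <-]; exists x.
have [V Vy [cV fV]] := Vcov y.
apply: subclosed_compact fV _.
  move/continuous_closedP: cf; apply.
  by apply: accessible_closed_set1; exact: hausdorff_accessible.
by move=> x /= ->; exact: nbhs_singleton.
Qed.

(** Preimages under the inverse are images under [f], so closedness of [f] gives continuity of the
    inverse, and continuity of [f] gives its closedness. *)
Lemma bijective_pzlc_iso (X Y : PZLC) (f : hom X Y) :
  injective (pzlc_fun f) -> (forall y, exists x, pzlc_fun f x = y) -> is_iso f.
Proof.
move=> fI /choice[g gK].
have fK : cancel (pzlc_fun f) g by move=> x; apply: fI; rewrite gK.
have pf := pzlc_perfect f.
have preg A : g @^-1` A = pzlc_fun f @` A.
  apply/seteqP; split=> [y Ay|_ [x Ax <-]]; last by rewrite /preimage /= fK.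
  by exists (g y).
have img B : g @` B = pzlc_fun f @^-1` B.
  apply/seteqP; split=> [_ [y By <-]|x Bx]; first by rewrite /preimage /= gK.
  by exists (pzlc_fun f x).
have pg : perfect_map g.
  split=> [|A cA|x].
  - by apply/continuous_closedP => A cA; rewrite preg; exact: perfect_closed.
  - rewrite img; move: A cA; apply/continuous_closedP.
    exact: perfect_continuous.
  - by rewrite preg image_set1; exact: compact_set1.
exists (PzlcHom pg).
by split; apply: pzlc_hom_eq; apply/funext => x /=.
Qed.

(** * The lattice of compact open sets *)

Record compact_open (X : pzlc_obj) := CompactOpen {
  co_set :> set X;
  co_compact : compact co_set;
  co_open : open co_set
}.

Section CompactOpen.
Variable X : pzlc_obj.
Implicit Types U V W : compact_open X.

Lemma compact_open_eq U V : co_set U = co_set V -> U = V.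
Proof.
case: U V => [U cU oU] [V cV oV] /= UV; rewrite UV in cU oU *.
by congr CompactOpen; exact: Prop_irrelevance.
Qed.

Lemma co_closed U : closed U.
Proof.
by apply: compact_closed; [exact: pzlc_hausdorff|exact: co_compact].
Qed.

Lemma compact_clopen_sub (A : set X) U : clopen A -> A `<=` U -> compact A.
Proof.
by move=> [_ cA] AU; apply: subclosed_compact AU => //; exact: co_compact.
Qed.

Definition co0 : compact_open X := CompactOpen (@compact0 X) (@open0 X).

Definition coU U V : compact_open X :=
  CompactOpen (compactU (@co_compact _ U) (@co_compact _ V))
    (openU (@co_open _ U) (@co_open _ V)).

Definition coI U V : compact_open X :=
  CompactOpen (compact_clopen_sub
      (clopenI (conj (@co_open _ U) (@co_closed U))
               (conj (@co_open _ V) (@co_closed V))) (@subIsetl _ U V))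
    (openI (@co_open _ U) (@co_open _ V)).

Lemma clopenD (A B : set X) : clopen A -> clopen B -> clopen (A `\` B).
Proof. by move=> cA cB; rewrite setDE; apply: clopenI => //; exact: clopenC. Qed.

Definition coD U V : compact_open X :=
  let UV := clopenD (conj (@co_open _ U) (@co_closed U))
                    (conj (@co_open _ V) (@co_closed V)) in
  CompactOpen (compact_clopen_sub UV (@subDsetl _ U V)) UV.1.

Definition co_le U V := `[< U `<=` V >].

Lemma co_le_refl : reflexive co_le.
Proof. by move=> U; apply/asboolP. Qed.

Lemma co_le_anti : antisymmetric co_le.
Proof.
move=> U V /andP[/asboolP UV /asboolP VU].
by apply: compact_open_eq; apply/seteqP.
Qed.

Lemma co_le_trans : transitive co_le.
Proof.
by move=> V U W /asboolP UV /asboolP VW; apply/asboolP; exact: subset_trans VW.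
Qed.

HB.instance Definition _ := gen_eqMixin (compact_open X).
HB.instance Definition _ := gen_choiceMixin (compact_open X).
HB.instance Definition _ := Order.Le_isPOrder.Build Order.default_display
  (compact_open X) co_le_refl co_le_anti co_le_trans.

Lemma co_leE U V : (U <= V)%O = `[< U `<=` V >]. Proof. by []. Qed.

Let co_meetP U V W : (U <= coI V W)%O = (U <= V)%O && (U <= W)%O.
Proof.
by rewrite !co_leE -asbool_and -subsetI.
Qed.

Let co_joinP U V W : (coU U V <= W)%O = (U <= W)%O && (V <= W)%O.
Proof.
by rewrite !co_leE -asbool_and -subUset.
Qed.

HB.instance Definition _ := Order.POrder_MeetJoin_isLattice.Build
  Order.default_display (compact_open X) co_meetP co_joinP.

Let co_meetUl : left_distributive (Order.meet : compact_open X -> _) Order.join.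
Proof. by move=> U V W; apply: compact_open_eq; exact: setIUl. Qed.

HB.instance Definition _ := Order.Lattice_Meet_isDistrLattice.Build
  Order.default_display (compact_open X) co_meetUl.

Let co0_le U : (co0 <= U)%O.
Proof. by apply/asboolP; exact: sub0set. Qed.

HB.instance Definition _ := Order.hasBottom.Build
  Order.default_display (compact_open X) co0_le.

Lemma co_complement U V W : (V <= U)%O -> (U <= W)%O ->
  exists T : compact_open X, (U `&` T = V /\ U `|` T = W)%O.
Proof.
(* Inside [U] the complement must be [V]; outside [U] it must be all of [W]. *)
move=> /asboolP VU /asboolP UW; exists (coU V (coD W U)).
split; apply: compact_open_eq.
  change (U `&` (V `|` W `\` U) = V).
  by rewrite setIUr setDIK setU0 setIC; exact: setIidl.
change (U `|` (V `|` W `\` U) = W).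
rewrite setUA (setUidl VU); exact: setDUK.
Qed.

(** A basic clopen set chosen inside both [A] and a compact neighbourhood of [x] is closed in a
    compact set, hence compact. *)
Lemma nbhs_compact_open (x : X) (A : set X) :
  nbhs x A -> exists2 U : compact_open X, co_set U x & U `<=` A.
Proof.
move=> Ax; have [B [Bo Bx] Bclopen] := pzlc_clopen_base X.
have [K] := [elaborate @pzlc_locally_compact X x I].
rewrite withinET => Kx [cK _].
have [V [BV Vx] VAK] := Bx x _ (filterI Ax Kx).
have [oV cV] := Bclopen _ BV.
have cptV : compact V by apply: subclosed_compact cK _ => // y /VAK[].
by exists (CompactOpen cptV oV) => // y /VAK[].
Qed.

Lemma compact_sub_compact_open (K : set X) :
  compact K -> exists U : compact_open X, K `<=` U.
Proof.
move=> cK.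
have [||x Kx|_ [U _ <-] KU] :=
  @compact_directed_cover _ K (range (@co_set X)) cK.
- by exists co0.
- by move=> _ _ [U _ <-] [V _ <-]; exists (coU U V).
- have [U Ux _] := @nbhs_compact_open x setT filterT.
  by exists U; [exists U|split=> //; exact: co_open].
- by exists U.
Qed.

Definition compact_open_gbpl : gbpl_obj := GbplObj co_complement.

End CompactOpen.

Section CompactOpenPreimage.
Variables (X Y : pzlc_obj) (f : pzlc_hom X Y).

Definition co_preimage (V : compact_open Y) : compact_open X :=
  CompactOpen (perfect_preimage_compact (pzlc_perfect f) (@co_compact _ V))
    ((continuousP _).1 (perfect_continuous (pzlc_perfect f)) _ (@co_open _ V)).

Lemma co_preimage_morphism :
  pseudolattice0_morphism
    (co_preimage : compact_open_gbpl Y -> compact_open_gbpl X).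
Proof. by split=> [|U V|U V]; apply: (@compact_open_eq X). Qed.

(** The image of a compact open [U] is compact, so it lies in some compact open [V], and then [U]
    lies in the preimage of [V]. *)
Lemma co_preimage_cofinal :
  cofinal_map (co_preimage : compact_open_gbpl Y -> compact_open_gbpl X).
Proof.
move=> U; have cfU : compact (f @` U).
  apply: continuous_compact (@co_compact _ U).
  by apply: continuous_subspaceT; exact: perfect_continuous (pzlc_perfect f).
have [V fUV] := compact_sub_compact_open cfU.
by exists V; apply/asboolP => x Ux; apply: fUV; exists x.
Qed.

Definition co_preimage_hom :
    gbpl_hom (compact_open_gbpl Y) (compact_open_gbpl X) :=
  GbplHom co_preimage_morphism co_preimage_cofinal.

End CompactOpenPreimage.

Definition compact_open_functor : functor PZLC (opposite GBPL).
Proof.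
apply: (@Functor PZLC (opposite GBPL) compact_open_gbpl co_preimage_hom).
- by move=> X; apply: gbpl_hom_eq; apply/funext => U; exact: compact_open_eq.
- move=> X Y Z g f; apply: gbpl_hom_eq; apply/funext => U.
  exact: compact_open_eq.
Defined.

(** * The space of prime filters *)

(** Nonemptiness stands in for containing a top. The equivalence in [pf_meet] combines closure under
    meets with upward closure. *)
Record prime_filter d (A : bDistrLatticeType d) := PrimeFilter {
  pf_mem :> set A;
  pf_nonempty : exists a, pf_mem a;
  pf_bot : ~ pf_mem \bot%O;
  pf_meet : forall a b, pf_mem (a `&` b)%O <-> pf_mem a /\ pf_mem b;
  pf_join : forall a b, pf_mem (a `|` b)%O <-> pf_mem a \/ pf_mem b
}.

Section PrimeFilter.
Context d (A : bDistrLatticeType d).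
Implicit Types (a b c : A) (p q : prime_filter A).

Lemma prime_filter_eq p q : (forall a, pf_mem p a <-> pf_mem q a) -> p = q.
Proof.
move=> pq; have {}pq : pf_mem p = pf_mem q by apply/seteqP; split=> a /pq.
case: p q pq => [p p1 p2 p3 p4] [q q1 q2 q3 q4] /= pq.
rewrite pq in p1 p2 p3 p4 *.
by congr PrimeFilter; exact: Prop_irrelevance.
Qed.

Lemma pf_le p a b : (a <= b)%O -> pf_mem p a -> pf_mem p b.
Proof. by move=> /meet_idPl <- /pf_meet[]. Qed.

HB.instance Definition _ := gen_eqMixin (prime_filter A).
HB.instance Definition _ := gen_choiceMixin (prime_filter A).

Definition basic a : set (prime_filter A) := [set p | pf_mem p a].

Lemma basicI a b : basic (a `&` b)%O = basic a `&` basic b.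
Proof. by apply/seteqP; split=> p /pf_meet. Qed.

Lemma basicU a b : basic (a `|` b)%O = basic a `|` basic b.
Proof. by apply/seteqP; split=> p /pf_join. Qed.

Lemma basic0 : basic \bot%O = set0.
Proof. by apply/seteqP; split=> p // /pf_bot. Qed.

(** The sets [basic a] cover the space and are closed under binary intersection, so they are a base
    and not merely a subbase. *)
Definition pf_open (U : set (prime_filter A)) :=
  forall p, U p -> exists2 a, pf_mem p a & basic a `<=` U.

Let pf_openT : pf_open setT.
Proof. by move=> p _; have [a pa] := pf_nonempty p; exists a. Qed.

Let pf_openI : setI_closed pf_open.
Proof.
move=> U V oU oV p [/oU[a pa aU] /oV[b pb bV]].
exists (a `&` b)%O; first by apply/pf_meet.
by rewrite basicI; exact: setISS.
Qed.

Let pf_open_bigU (I : Type) (f : I -> set (prime_filter A)) :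
  (forall i, pf_open (f i)) -> pf_open (\bigcup_i f i).
Proof.
move=> of_ p [i _ /of_[a pa af]]; exists a => //.
by apply: subset_trans af _; exact: bigcup_sup.
Qed.

HB.instance Definition _ := isOpenTopological.Build (prime_filter A)
  pf_openT pf_openI pf_open_bigU.

Lemma pf_openE (U : set (prime_filter A)) : open U = pf_open U.
Proof. by []. Qed.

Lemma basic_open a : open (basic a).
Proof. by rewrite pf_openE => p pa; exists a. Qed.

Lemma basic_nbhs p a : pf_mem p a -> nbhs p (basic a).
Proof. by move=> pa; apply: open_nbhs_nbhs; split=> //; exact: basic_open. Qed.

Lemma nbhs_basic p (U : set (prime_filter A)) :
  nbhs p U -> exists2 a, pf_mem p a & basic a `<=` U.
Proof.
rewrite nbhsE => -[V [oV Vp] VU]; have [a pa aV] := oV p Vp.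
by exists a => //; exact: subset_trans VU.
Qed.

(* An ultrafilter [F] containing [basic a] converges to the prime filter of
   those [b] such that [basic b] belongs to [F]. *)
Lemma basic_compact a : compact (basic a).
Proof.
rewrite compact_ultra => F UF Fa.
have PF : ProperFilter F := ultra_proper.
have pI b c : F (basic (b `&` c)%O) <-> F (basic b) /\ F (basic c).
  rewrite basicI; split=> [Fbc|[Fb Fc]]; last exact: filterI.
  by split; apply: filterS Fbc; [exact: subIsetl|exact: subIsetr].
have pU b c : F (basic (b `|` c)%O) <-> F (basic b) \/ F (basic c).
  rewrite basicU; split=> [Fbc|[]]; last first.
  - by apply: filterS; exact: subsetUr.
  - by apply: filterS; exact: subsetUl.
  have [|nFb] := in_ultra_setVsetC (basic b) UF; [by left|right].
  by apply: filterS (filterI Fbc nFb) => p [[]].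
have p0 : ~ F (basic \bot%O) by rewrite basic0; exact: filter_not_empty.
have pex : exists b, [set b | F (basic b)] b by exists a.
exists (PrimeFilter pex p0 pI pU).
split=> // U /nbhs_basic[b Fb bU]; exact: filterS Fb.
Qed.

(** The basic sets contained in [K] are directed by joins and cover [K], so by compactness a single
    one of them is all of [K]. *)
Lemma basic_of_compact_open (K : set (prime_filter A)) :
  compact K -> open K -> exists a, K = basic a.
Proof.
move=> cK oK.
pose P := [set U | U `<=` K /\ exists a, U = basic a].
have [|U V [UK [a Ua]] [VK [b Vb]]|p Kp|U [UK [a Ua]] KU] :=
    @compact_directed_cover _ K P cK.
- by split; [exact: sub0set|exists \bot%O; rewrite basic0].
- split; first by rewrite subUset.
  by exists (a `|` b)%O; rewrite basicU Ua Vb.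
- have [a pa aK] := oK p Kp.
  by exists (basic a); [split=> //; exists a|split=> //; exact: basic_open].
- by exists a; rewrite -Ua; apply/seteqP.
Qed.

(* A filter maximal among those whose elements all meet [c] is prime. *)
Lemma prime_filter_exists c : c != \bot%O -> exists p : prime_filter A, pf_mem p c.
Proof.
move=> c0.
pose P (F : set A) := [/\ forall a b, F a -> F b -> F (a `&` b)%O,
  forall a b, F a -> (a <= b)%O -> F b & forall a, F a -> (a `&` c)%O != \bot%O].
have [F [[FI Fle Fc] Fmax]] : exists F, P F /\ forall G, F `<` G -> ~ P G.
  apply: Zorn_bigcup => C CP Ctot.
  split=> [a b [F CF Fa] [G CG Gb]|a b [F CF Fa] ab|a [F CF Fa]].
  - have [FG|GF] := Ctot _ _ CF CG.
      by exists G => //; have [GI _ _] := CP _ CG; apply: GI => //; exact: FG.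
    by exists F => //; have [FI _ _] := CP _ CF; apply: FI => //; exact: GF.
  - by exists F => //; have [_ Fle _] := CP _ CF; exact: Fle ab.
  - by have [_ _] := CP _ CF; exact.
have adjoin a : (a `&` c)%O != \bot%O ->
    (forall b, F b -> (b `&` a `&` c)%O != \bot%O) -> F a.
  move=> ac Fac; apply: contrapT => nFa.
  (* The filter generated by [F] and [a]; the first disjunct puts [a] into it even if [F] is
     empty. *)
  pose G := [set x | (a <= x)%O \/ exists2 b, F b & (b `&` a <= x)%O].
  apply: (Fmax G).
    split=> [x Fx|GF]; last by apply: nFa; apply: GF; left.
    by right; exists x => //; exact: leIl.
  split=> [x y [ax|[b Fb bx]] [ay|[b' Fb' by_]]|x y [ax|[b Fb bx]] xy
          |x [ax|[b Fb bx]]].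
  - by left; rewrite lexI ax ay.
  - right; exists b' => //; rewrite lexI by_ andbT.
    by apply: le_trans ax; exact: leIr.
  - right; exists b => //; rewrite lexI bx /=.
    by apply: le_trans ay; exact: leIr.
  - right; exists (b `&` b')%O; first exact: FI.
    rewrite lexI (le_trans _ bx) ?(le_trans _ by_) //.
      by apply: leI2 => //; exact: leIr.
    by apply: leI2 => //; exact: leIl.
  - by left; exact: le_trans xy.
  - by right; exists b => //; exact: le_trans xy.
  - by apply: contra_neq ac => xc; apply/eqP; rewrite -lex0 -xc leI2.
  - apply: contra_neq (Fac b Fb) => xc.
    by apply/eqP; rewrite -lex0 -xc leI2.
have Fcc : F c.
  by apply: adjoin => [|b Fb]; rewrite -?meetA meetxx //; exact: Fc.
have refute a : ~ F a -> exists2 b, F b & (b `&` a `&` c)%O = \bot%O.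
  move=> nFa; apply: contrapT => nb; apply: nFa; apply: adjoin => [|b Fb].
    (* If [a] is already disjoint from [c], the element [c] of [F] is the witness. *)
    by apply/eqP => ac; apply: nb; exists c => //; rewrite -meetA ac meetx0.
  by apply/eqP => bac; apply: nb; exists b.
have F0 : ~ F \bot%O by move=> /Fc; rewrite meet0x eqxx.
have FmI a b : F (a `&` b)%O <-> F a /\ F b.
  split=> [Fab|[Fa Fb]]; last exact: FI.
  by split; apply: Fle Fab _; [exact: leIl|exact: leIr].
have FjU a b : F (a `|` b)%O <-> F a \/ F b.
  split=> [Fab|[Fa|Fb]]; [|exact: Fle Fa (leUl _ _)|exact: Fle Fb (leUr _ _)].
  (* By distributivity the element of [F] obtained by meeting [a'], [b'] and the join of [a] and [b]
     is disjoint from [c], which is impossible. *)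
  apply: contrapT => /not_orP[/refute[a' Fa' a'0] /refute[b' Fb' b'0]].
  have := Fc _ (FI _ _ (FI _ _ Fa' Fb') Fab); apply/negP; rewrite negbK.
  rewrite meetUr meetUl join_eq0; apply/andP; split.
    by rewrite -lex0 -a'0 leI2 // leI2 // leIl.
  by rewrite -lex0 -b'0 leI2 // leI2 // leIr.
by exists (PrimeFilter (ex_intro _ c Fcc) F0 FmI FjU).
Qed.

End PrimeFilter.

(** * Separation and clopen sets in the prime filter space *)

Section PrimeFilterSpace.
Variable A : gbpl_obj.
Implicit Types (a b : A) (p q : prime_filter A).

(** Here [c] is the difference of [b] and [a], a complement taken in the interval from bottom to [b]
    since there may be no top. *)
Lemma relative_complement a b :
  exists c : A, ((a `&` b) `&` c = \bot /\ (a `&` b) `|` c = b)%O.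
Proof. by apply: gbpl_complement; [exact: le0x|exact: leIr]. Qed.

Lemma basic_clopen a : clopen (basic a).
Proof.
split; first exact: basic_open.
rewrite -openC pf_openE => p npa; have [b pb] := pf_nonempty p.
have [c [ac0 acb]] := relative_complement a b.
have cb : (c <= b)%O by rewrite -acb leUr.
(* A prime filter containing [b] but not [a] contains the difference [c], and no prime filter
   contains both [c] and [a]. *)
exists c => [|q qc qa].
  by move: pb; rewrite -acb => /pf_join[/pf_meet[]|].
by apply: (pf_bot (p := q)); rewrite -ac0 !pf_meet; have := pf_le cb qc.
Qed.

(** Prime filters are maximal here: if [a] is in [q] but not in [p], then the difference of some [b]
    in [p] and [a] lies in [p], hence in [q], although it is disjoint from [a]. *)
Lemma prime_filter_separated p q : (forall a, pf_mem p a -> pf_mem q a) -> p = q.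
Proof.
move=> pq; apply: prime_filter_eq => a; split; first exact: pq.
move=> qa; have [b pb] := pf_nonempty p.
have [c [ac0 acb]] := relative_complement a b.
move: pb; rewrite -acb => /pf_join[/pf_meet[]//|/pq qc].
have cb : (c <= b)%O by rewrite -acb leUr.
exfalso; apply: (pf_bot (p := q)); rewrite -ac0 !pf_meet.
by have := pf_le cb qc.
Qed.

Lemma prime_filter_hausdorff : hausdorff_space (prime_filter A).
Proof.
move=> p q pq; apply: prime_filter_separated => a pa.
have [_ ca] := basic_clopen a; apply: ca => U Uq.
by apply: pq => //; exact: basic_nbhs.
Qed.

Lemma prime_filter_locally_compact : locally_compact [set: prime_filter A].
Proof.
move=> p _; have [a pa] := pf_nonempty p; exists (basic a).
  by rewrite withinET; exact: basic_nbhs.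
by split; [exact: basic_compact|have [] := basic_clopen a].
Qed.

Lemma prime_filter_clopen_base : has_clopen_base (prime_filter A).
Proof.
exists (range (@basic _ A)); last by move=> _ [a _ <-]; exact: basic_clopen.
split=> [_ [a _ <-]|p U /nbhs_basic[a pa aU]]; first exact: basic_open.
by exists (basic a) => //; split=> //; exists a.
Qed.

Definition prime_filter_pzlc : pzlc_obj :=
  PzlcObj prime_filter_locally_compact prime_filter_clopen_base
    prime_filter_hausdorff.

(** A nonzero difference of [a] and [b] would belong to a prime filter containing [a], hence [b],
    which is absurd. *)
Lemma basic_le a b : basic a `<=` basic b -> (a <= b)%O.
Proof.
move=> ab; have [c [bc0 bca]] := relative_complement b a.
have [c0|/prime_filter_exists[p pc]] := eqVneq c \bot%O.
  by rewrite -bca c0 joinx0 leIl.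
have ca : (c <= a)%O by rewrite -bca leUr.
exfalso; apply: (pf_bot (p := p)); rewrite -bc0 !pf_meet.
by have pa := pf_le ca pc; have pb := ab p pa.
Qed.

Lemma basic_inj : injective (@basic _ A).
Proof. by move=> a b ab; apply: le_anti; rewrite !basic_le // ab. Qed.

End PrimeFilterSpace.

(** Every prime filter has a clopen neighbourhood [basic a], which serves as the closed
    neighbourhood with compact preimage. *)
Lemma perfect_of_basic_preimage (X : topologicalType) (A : gbpl_obj)
    (f : X -> prime_filter A) :
  (forall a, compact (f @^-1` basic a)) -> (forall a, open (f @^-1` basic a)) ->
  perfect_map f.
Proof.
move=> cptf openf; apply: locally_compact_preimage_perfect.
- exact: prime_filter_hausdorff.
- move=> x U /nbhs_basic[a fa aU]; apply: (filterS (preimage_subset aU)).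
  by apply: (@open_nbhs_nbhs _ x (f @^-1` basic a)); split.
- move=> p; have [a pa] := pf_nonempty p; exists (basic a).
    exact: basic_nbhs.
  by split=> //; have [] := basic_clopen a.
Qed.

(** * Homomorphisms as perfect maps of prime filter spaces *)

Section PrimeFilterPreimage.
Variables (A B : gbpl_obj) (f : gbpl_hom A B).

Lemma pf_preimage_nonempty (p : prime_filter B) : exists a, (f @^-1` pf_mem p) a.
Proof.
have [b pb] := pf_nonempty p; have [a ba] := gbpl_cofinal f b.
by exists a; exact: pf_le pb.
Qed.

Lemma pf_preimage_bot (p : prime_filter B) : ~ (f @^-1` pf_mem p) \bot%O.
Proof. by rewrite /preimage /= (pm_bot (gbpl_morphism f)); exact: pf_bot. Qed.

Lemma pf_preimage_meet (p : prime_filter B) a b :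
  (f @^-1` pf_mem p) (a `&` b)%O <-> (f @^-1` p) a /\ (f @^-1` p) b.
Proof. by rewrite /preimage /= (pm_meet (gbpl_morphism f)); exact: pf_meet. Qed.

Lemma pf_preimage_join (p : prime_filter B) a b :
  (f @^-1` pf_mem p) (a `|` b)%O <-> (f @^-1` p) a \/ (f @^-1` p) b.
Proof. by rewrite /preimage /= (pm_join (gbpl_morphism f)); exact: pf_join. Qed.

Definition pf_preimage (p : prime_filter B) : prime_filter A :=
  PrimeFilter (pf_preimage_nonempty p) (@pf_preimage_bot p)
    (pf_preimage_meet p) (pf_preimage_join p).

(** The preimage of [basic a] is [basic (f a)] by computation. *)
Lemma pf_preimage_perfect : perfect_map pf_preimage.
Proof.
apply: perfect_of_basic_preimage => a.
  exact: (@basic_compact _ _ (f a)).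
exact: (@basic_open _ _ (f a)).
Qed.

Definition pf_preimage_hom :
    pzlc_hom (prime_filter_pzlc B) (prime_filter_pzlc A) :=
  @PzlcHom (prime_filter_pzlc B) (prime_filter_pzlc A) _ pf_preimage_perfect.

End PrimeFilterPreimage.

Definition prime_filter_functor : functor (opposite GBPL) PZLC.
Proof.
apply: (@Functor (opposite GBPL) PZLC prime_filter_pzlc
  (fun A B f => pf_preimage_hom f)).
- by move=> A; apply: pzlc_hom_eq; apply/funext => p; exact: prime_filter_eq.
- move=> A B C g f; apply: pzlc_hom_eq; apply/funext => p.
  exact: prime_filter_eq.
Defined.

(** * The natural isomorphisms *)

Section PointFilter.
Variable X : pzlc_obj.

Lemma point_filter_nonempty (x : X) :
  exists U : compact_open_gbpl X, [set U : compact_open X | co_set U x] U.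
Proof.
by have [U Ux _] := @nbhs_compact_open X x setT filterT; exists U.
Qed.

Definition point_filter (x : X) : prime_filter (compact_open_gbpl X) :=
  @PrimeFilter _ (compact_open_gbpl X) [set U : compact_open X | co_set U x]
    (point_filter_nonempty x) id (fun U V => iff_refl _) (fun U V => iff_refl _).

Lemma point_filter_perfect : perfect_map point_filter.
Proof.
by apply: perfect_of_basic_preimage => U; [exact: co_compact|exact: co_open].
Qed.

Definition point_filter_hom :
    pzlc_hom X (prime_filter_pzlc (compact_open_gbpl X)) :=
  @PzlcHom X (prime_filter_pzlc (compact_open_gbpl X)) _ point_filter_perfect.

(** Compact open sets form a base, so [y] lies in every neighbourhood of [x], and the Hausdorff
    property identifies them. *)
Lemma point_filter_inj : injective point_filter.
Proof.
move=> x y xy; apply: (@pzlc_hausdorff X) => A B Ax By.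
have [U Ux UA] := nbhs_compact_open Ax.
exists y; split; last exact: nbhs_singleton.
apply: UA; change (pf_mem (point_filter y) U).
by rewrite -xy.
Qed.

(** The members of [p] generate a proper filter on a compact set. Its cluster point [x] lies in each
    of them, as they are closed, so [p] is contained in [point_filter x]; maximality of prime
    filters gives equality. *)
Lemma point_filter_surj (p : prime_filter (compact_open_gbpl X)) :
  exists x, point_filter x = p.
Proof.
have [K pK] := pf_nonempty p.
pose F := filter_from (pf_mem p) (@co_set X).
have PF : ProperFilter F.
  apply: filter_from_proper.
    apply: filter_from_filter; first by exists K.
    by move=> U V pU pV; exists (coI U V) => //; apply/pf_meet.
  move=> U pU; apply: contrapT => /nonemptyPn U0; apply: (pf_bot (p := p)).
  suff <- : U = \bot%O :> compact_open_gbpl X by [].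
  exact: compact_open_eq.
have [|x [Kx xF]] := @co_compact X K F PF; first by exists K.
exists x; apply/esym/prime_filter_separated => U pU.
by apply: co_closed => V Vx; apply: xF => //; exists U.
Qed.

End PointFilter.

Section BasicCompactOpen.
Variable A : gbpl_obj.

Definition basic_co (a : A) : compact_open (prime_filter_pzlc A) :=
  @CompactOpen (prime_filter_pzlc A) _ (@basic_compact _ A a) (@basic_open _ A a).

Lemma basic_co_surj (U : compact_open (prime_filter_pzlc A)) :
  exists a, basic_co a = U.
Proof.
have [a Ua] := @basic_of_compact_open _ A U (@co_compact _ U) (@co_open _ U).
by exists a; exact: compact_open_eq.
Qed.

Lemma basic_co_morphism : pseudolattice0_morphism
  (basic_co : A -> compact_open_gbpl (prime_filter_pzlc A)).
Proof.
split=> [|a b|a b]; apply: compact_open_eq.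
- exact: basic0.
- exact: basicI.
- exact: basicU.
Qed.

Lemma basic_co_cofinal :
  cofinal_map (basic_co : A -> compact_open_gbpl (prime_filter_pzlc A)).
Proof. by move=> U; have [a <-] := basic_co_surj U; exists a. Qed.

Definition basic_co_hom : gbpl_hom A (compact_open_gbpl (prime_filter_pzlc A)) :=
  GbplHom basic_co_morphism basic_co_cofinal.

Lemma basic_co_inj : injective basic_co.
Proof. by move=> a b /(congr1 (@co_set _)); exact: basic_inj. Qed.

End BasicCompactOpen.

Lemma bijective_gbpl_iso (A B : GBPL) (f : hom A B) :
  injective (gbpl_fun f) -> (forall b, exists a, gbpl_fun f a = b) -> is_iso f.
Proof.
move=> fI /choice[g gK].
have fK : cancel (gbpl_fun f) g by move=> a; apply: fI; rewrite gK.
have [f0 fM fJ] := gbpl_morphism f.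
have mg : pseudolattice0_morphism g.
  by split=> [|x y|x y]; apply: fI; rewrite ?f0 ?fM ?fJ !gK.
have cg : cofinal_map g by move=> a; exists (gbpl_fun f a); rewrite fK.
exists (GbplHom mg cg).
by split; apply: gbpl_hom_eq; apply/funext => x /=.
Qed.

Lemma is_iso_opposite (C : category) (X Y : C) (f : hom X Y) :
  is_iso f -> @is_iso (opposite C) Y X f.
Proof. by move=> [g [gf fg]]; exists g. Qed.

Theorem theorem1p26 : dually_equivalent PZLC GBPL.
Proof.
exists compact_open_functor, prime_filter_functor; split.
  exists point_filter_hom; split=> [X|X Y f].
    apply: bijective_pzlc_iso; first exact: point_filter_inj.
    exact: point_filter_surj.
  (* Both composites send [x] to the compact open sets containing [f x]. *)
  by apply: pzlc_hom_eq; apply/funext => x; exact: prime_filter_eq.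
(* A morphism to [A] in the opposite category is a homomorphism out of [A], so [basic_co_hom] points
   the right way. *)
exists basic_co_hom; split=> [A|A B f].
  apply: is_iso_opposite; apply: bijective_gbpl_iso.
    exact: basic_co_inj.
  exact: basic_co_surj.
by apply: gbpl_hom_eq; apply/funext => a; exact: compact_open_eq.
Qed.
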